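(* One nearest-neighbor (1NN) is a consistent learner. That is, for every $d$, every $d$-dimensional feature set $F$ and every training set $T$: if there is a function $h$ in the hypothesis space $H_d$ of the $d$-dimensional 1NN learning algorithm $\ell_d$ such that $h\circ F$ is consistent with $T$, then $\ell_d(F,T)\circ F$ is consistent with $T$.
   Context: $X$ is a set of objects and $Y$ a set of labels. A feature is a function $X\to\mathbb{R}$; a $d$-dimensional feature set $F=\{f_1,\dots,f_d\}$ maps $x\in X$ to $F(x)=(f_1(x),\dots,f_d(x))\in\mathbb{R}^d$. A training set is a finite nonempty set $T\subset X\times Y$ containing at most one label per object. A classification function $c:X\to Y$ is consistent with $T$ if $c(x)=y$ for all $(x,y)\in T$. A $d$-dimensional learning algorithm $\ell_d$ takes a $d$-dimensional feature set $F$ and a training set $T$ and outputs a function $\mathbb{R}^d\to Y$; its hypothesis space $H_d$ is the image of $\ell_d$ (over all $F$ and $T$). The 1NN learning algorithm: given $F$ and $T$, the output $\ell_d(F,T)$ sends $z\in\mathbb{R}^d$ to the label in $T$ of a training object $x$ for which the Euclidean distance from $z$ to $F(x)$ is minimal among the training objects; if there are several such training objects, one of them is chosen as canonical by a fixed rule (e.g. according to some fixed ordering over the objects). *)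

(* Defs.v *)
From HB Require Import structures.
From mathcomp Require Import all_boot all_order all_algebra.
From mathcomp Require Import boolp classical_sets functions cardinality reals.

Set Implicit Arguments.
Unset Strict Implicit.
Unset Printing Implicit Defensive.

Import Order.TTheory GRing.Theory Num.Theory.
Local Open Scope classical_set_scope.
Local Open Scope ring_scope.

Definition feature_set (R : realType) (X : Type) (d : nat) := 'I_d -> X -> R.

Definition feature_map (R : realType) (X : Type) (d : nat)
    (F : feature_set R X d) (x : X) : 'rV[R]_d :=
  \row_(i < d) F i x.

Record training_set (X Y : Type) := TrainingSet {
  examples :> set (X * Y);
  examples_finite : finite_set examples;
  examples_neq0 : examples !=set0;
  examples_fun : forall x y y', examples (x, y) -> examples (x, y') -> y = y'
}.

Definition objects (X Y : Type) (T : training_set X Y) : set X :=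
  [set x | exists y, examples T (x, y)].

Definition consistent (X Y : Type) (c : X -> Y) (T : training_set X Y) : Prop :=
  forall x y, examples T (x, y) -> c x = y.

Definition learning_algorithm (R : realType) (X Y : Type) (d : nat) :=
  feature_set R X d -> training_set X Y -> 'rV[R]_d -> Y.

Definition hypothesis_space (R : realType) (X Y : Type) (d : nat)
    (l : learning_algorithm R X Y d) : set ('rV[R]_d -> Y) :=
  [set h | exists F T, h = l F T].

Definition consistent_learner (R : realType) (X Y : Type)
    (l : forall d, learning_algorithm R X Y d) : Prop :=
  forall (d : nat) (F : feature_set R X d) (T : training_set X Y),
    (exists2 h, hypothesis_space (l d) h & consistent (h \o feature_map F) T) ->
    consistent (l d F T \o feature_map F) T.

(* The library norm on 'rV[R]_d is the sup norm, hence the explicit formula. *)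
Definition euclidean_dist (R : realType) (d : nat) (u v : 'rV[R]_d) : R :=
  Num.sqrt (\sum_(i < d) (u ord0 i - v ord0 i) ^+ 2).

Definition nearest (R : realType) (X Y : Type) (d : nat) (F : feature_set R X d)
    (T : training_set X Y) (z : 'rV[R]_d) : set X :=
  [set x | objects T x /\ forall x', objects T x' ->
     euclidean_dist z (feature_map F x) <= euclidean_dist z (feature_map F x')].

(* A tie-breaking rule picks the canonical element of every finite nonempty set
   of tied objects; taking the least element for a fixed total order on X is an
   instance. The value of [canonical] on other sets is irrelevant. *)
Record tie_rule (X : Type) := TieRule {
  canonical : set X -> X;
  canonical_in : forall A, finite_set A -> A !=set0 -> A (canonical A)
}.

Lemma finite_argmin (R : realType) (X : Type) (A : set X) (f : X -> R) :
  finite_set A -> A !=set0 ->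
  exists2 x, A x & forall x', A x' -> f x <= f x'.
Proof.
move=> /(@finite_seqP {classic X})[s ->] {A}; elim: s => [[x]//|a s IH] _.
have [[b bs]|s0] := pselect ([set` s] !=set0); last first.
  exists a => /=; first by rewrite mem_head.
  move=> x' /=; rewrite inE => /orP[/eqP->//|x's].
  by case: s0; exists x'.
have [x xs xmin] := IH (ex_intro _ b bs).
have [fax|/ltW fxa] := leP (f a) (f x).
  exists a => /=; first by rewrite mem_head.
  move=> x' /=; rewrite inE => /orP[/eqP->//|x's].
  exact: le_trans fax (xmin _ x's).
exists x => /=; first by rewrite inE; apply/orP; right.
by move=> x' /=; rewrite inE => /orP[/eqP->//|x's]; exact: xmin.
Qed.

Lemma objects_finite (X Y : Type) (T : training_set X Y) :
  finite_set (objects T).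
Proof.
apply: (sub_finite_set _ (finite_image fst (examples_finite T))).
by move=> x [y Txy]; exists (x, y).
Qed.

Lemma objects_neq0 (X Y : Type) (T : training_set X Y) : objects T !=set0.
Proof. by have [[x y] Txy] := examples_neq0 T; exists x, y. Qed.

Lemma nearest_finite (R : realType) (X Y : Type) (d : nat)
    (F : feature_set R X d) (T : training_set X Y) (z : 'rV[R]_d) :
  finite_set (nearest F T z).
Proof. by apply: (sub_finite_set _ (objects_finite T)) => x []. Qed.

Lemma nearest_neq0 (R : realType) (X Y : Type) (d : nat)
    (F : feature_set R X d) (T : training_set X Y) (z : 'rV[R]_d) :
  nearest F T z !=set0.
Proof.
have [x Tx xmin] := finite_argmin
  (fun x => euclidean_dist z (feature_map F x))
  (objects_finite T) (objects_neq0 T).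
by exists x.
Qed.

Lemma canonical_nearest (R : realType) (X Y : Type) (k : tie_rule X) (d : nat)
    (F : feature_set R X d) (T : training_set X Y) (z : 'rV[R]_d) :
  nearest F T z (canonical k (nearest F T z)).
Proof. exact: canonical_in (nearest_finite F T z) (nearest_neq0 F T z). Qed.

Definition label (X Y : Type) (T : training_set X Y) (x : X)
    (Tx : objects T x) : Y := sval (cid Tx).

Definition one_nn (R : realType) (X Y : Type) (k : tie_rule X) (d : nat) :
    learning_algorithm R X Y d :=
  fun F T z => label (proj1 (canonical_nearest k F T z)).

(* Main.v *)
(** The object [x'] chosen for [z = F x] is at distance [0] from [F x], so
    [F x' = F x]. A function [h] with [h \o F] consistent therefore forces the
    labels of [x] and [x'] to agree. *)

Require Import Defs.
From mathcomp Require Import all_boot all_order all_algebra.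
From mathcomp Require Import boolp reals.

Import Order.TTheory GRing.Theory Num.Theory.

(** A training object [x] is itself a candidate at distance 0 from its image, so any nearest [x']
    has the same feature vector ([nearest_feature_map]). Any [h] on feature vectors then takes one
    value at both, and if [h] fits [T], this value is both labels. *)

Lemma euclidean_distxx (R : realType) (d : nat) (u : 'rV[R]_d) :
  euclidean_dist u u = 0%R.
Proof.
by rewrite /euclidean_dist big1 ?sqrtr0 // => i _; rewrite subrr expr0n.
Qed.

Lemma euclidean_dist_le0 (R : realType) (d : nat) (u v : 'rV[R]_d) :
  (euclidean_dist u v <= 0)%R -> u = v.
Proof.
rewrite /euclidean_dist => uv0; apply/rowP => i.
have sum0 : (\sum_(i < d) (u ord0 i - v ord0 i) ^+ 2 = 0)%R.
  apply/eqP; rewrite eq_le sumr_ge0 ?andbT; last by move=> j _; exact: sqr_ge0.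
  by rewrite -sqrtr_eq0 eq_le uv0 sqrtr_ge0.
(* A vanishing sum of nonnegative squares has only zero terms. *)
have /(_ i isT)/eqP := psumr_eq0P (fun j _ => sqr_ge0 (u ord0 j - v ord0 j)%R) sum0.
by rewrite sqrf_eq0 subr_eq0 => /eqP.
Qed.

Lemma nearest_feature_map (R : realType) (X Y : Type) (d : nat)
    (F : feature_set R X d) (T : training_set X Y) (x x' : X) :
  objects T x -> nearest F T (feature_map F x) x' ->
  feature_map F x = feature_map F x'.
Proof.
move=> Tx [_ /(_ x Tx)]; rewrite euclidean_distxx.
exact: euclidean_dist_le0.
Qed.

Lemma labelP (X Y : Type) (T : training_set X Y) (x : X) (Tx : objects T x) :
  examples T (x, label Tx).
Proof. exact: svalP (cid Tx). Qed.

Theorem proposition5 (R : realType) (X Y : Type) (k : tie_rule X) :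
  consistent_learner (fun d : nat => @one_nn R X Y k d).
Proof.
move=> d F T [h _ hT] x y Txy; rewrite /= /one_nn.
set near := canonical_nearest _ _ _ _.
(* Both labels become values of [h], at the images of the chosen object and of [x]. *)
rewrite -(hT _ _ (labelP _ _ _ _ (proj1 near))) -(hT _ _ Txy) /=.
by rewrite -(nearest_feature_map _ _ _ _ _ _ _ _ (ex_intro _ y Txy) near).
Qed.
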